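(* If $f\in\mathcal B_1$ and the function $x\mapsto f(x)/x$ on $(0,\infty)$ is logarithmically completely monotonic, then $f^{\lambda}\in\mathcal B_\lambda$ for any $\lambda\ge 1$.
   Context: A function $g:(0,\infty)\to\mathbb R$ is completely monotonic if it is infinitely often differentiable and $(-1)^n g^{(n)}(x)\ge 0$ for all $n=0,1,2,\ldots$ and all $x>0$. A $C^\infty$-function $g:(0,\infty)\to(0,\infty)$ is logarithmically completely monotonic if $-g'/g$ is completely monotonic. For $\lambda>0$, a $C^\infty$-function $f:(0,\infty)\to(0,\infty)$ belongs to the class $\mathcal B_\lambda$ of generalized Bernstein functions of order $\lambda$ if $x\mapsto x^{1-\lambda}f'(x)$ is completely monotonic. *)

(* Defs.v *)
From Stdlib Require Import Reals.
From Coquelicot Require Import Coquelicot.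
Open Scope R_scope.

(** A function on (0,oo) is represented by a total function [R -> R]; all the
    notions below depend only on its values on the open half-line, since
    [Derive_n g n x] and [ex_derive_n g n x] are local at [x]. *)

Definition smooth_on_pos (g : R -> R) : Prop :=
  forall (n : nat) (x : R), 0 < x -> ex_derive_n g n x.

Definition positive_on_pos (g : R -> R) : Prop :=
  forall x : R, 0 < x -> 0 < g x.

Definition completely_monotonic (g : R -> R) : Prop :=
  smooth_on_pos g /\
  forall (n : nat) (x : R), 0 < x -> 0 <= (-1) ^ n * Derive_n g n x.

Definition log_completely_monotonic (g : R -> R) : Prop :=
  smooth_on_pos g /\ positive_on_pos g /\
  completely_monotonic (fun x => - Derive g x / g x).

(** Only meant for [0 < lambda]. *)
Definition gen_bernstein (lambda : R) (f : R -> R) : Prop :=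
  smooth_on_pos f /\ positive_on_pos f /\
  completely_monotonic (fun x => Rpower x (1 - lambda) * Derive f x).

(* Main.v *)
Require Import Defs.
From Stdlib Require Import Reals Lra.
From Coquelicot Require Import Coquelicot.
Open Scope R_scope.

(** Write [g x = f x / x].  On the half-line
    [x^(1-lambda) * (f^lambda)' = lambda * f' * g^(lambda-1)],
    so it is enough that [f'] and [g^(lambda-1)] are completely monotonic and
    that such functions are stable under products.  The first is [f] in [B_1].
    For the second, put [phi = - g'/g], which is completely monotonic by
    hypothesis; then [h = g^c] with [c >= 0] solves [- h' = c * phi * h], so
    that complete monotonicity of [h] up to order [n] yields it up to order
    [n + 1].

    To exploit such equations, complete monotonicity is replaced by the
    recursive notion [alternating] below, in which passing to order [n + 1]
    means passing from [g] to [- g'].  The product rule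
    [- (g h)' = (- g') h + g (- h')] then shows stability under products by a
    plain induction, where the Leibniz formula would otherwise be needed.  The
    sign condition is a parameter [Q]: with [Q] trivial the same notion
    expresses smoothness, so one set of closure lemmas also serves to prove
    that [f^lambda] is smooth. *)

(** The sign enters as an arbitrary predicate [Q] on values because only its
    stability under sums and products matters: [0 <= a] gives complete
    monotonicity up to order [n], and [True] gives [n]-fold
    differentiability. *)
Fixpoint alternating (Q : R -> Prop) (n : nat) (g : R -> R) : Prop :=
  (forall x, 0 < x -> Q (g x)) /\
  match n with
  | O => True
  | S m => exists g' : R -> R,
      (forall x, 0 < x -> is_derive g x (g' x)) /\
      alternating Q m (fun x => - g' x)
  end.

Definition add_mul_closed (Q : R -> Prop) : Prop :=
  forall a b, Q a -> Q b -> Q (a + b) /\ Q (a * b).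

Lemma nonneg_add_mul_closed : add_mul_closed (fun a => 0 <= a).
Proof.
intros a b Ha Hb; split; [lra | now apply Rmult_le_pos].
Qed.

Lemma true_add_mul_closed : add_mul_closed (fun _ => True).
Proof. easy. Qed.

Lemma locally_pos (x : R) : 0 < x -> locally x (fun y => 0 < y).
Proof. exact (open_gt 0 x). Qed.

(** * Iterated derivatives and alternating functions *)

(** Iterating the derivative from the inside is what the recursion of
    [alternating] needs, while [Derive_n] iterates from the outside. *)
Lemma Derive_n_S_pos (g g' : R -> R) (n : nat) (x : R) :
  (forall y, 0 < y -> is_derive g y (g' y)) -> 0 < x ->
  Derive_n g (S n) x = Derive_n g' n x.
Proof.
intros Hg; revert x; induction n as [|n IH]; intros x Hx.
- now apply is_derive_unique, Hg.
- change (Derive (Derive_n g (S n)) x = Derive (Derive_n g' n) x).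
  apply Derive_ext_loc; generalize (locally_pos x Hx); apply filter_imp.
  exact IH.
Qed.

Lemma ex_derive_n_S_pos (g g' : R -> R) (n : nat) (x : R) :
  (forall y, 0 < y -> is_derive g y (g' y)) -> 0 < x ->
  ex_derive_n g (S n) x <-> ex_derive_n g' n x.
Proof.
intros Hg Hx; destruct n as [|n].
- split; [easy | intros _; exists (g' x); now apply Hg].
- change (ex_derive (Derive_n g (S n)) x <-> ex_derive (Derive_n g' n) x).
  split; apply ex_derive_ext_loc; generalize (locally_pos x Hx);
    apply filter_imp; intros y Hy; [|symmetry];
    now apply Derive_n_S_pos.
Qed.

Lemma ex_derive_n_oppE (g : R -> R) (n : nat) (x : R) :
  ex_derive_n (fun y => - g y) n x -> ex_derive_n g n x.
Proof.
intros H; apply ex_derive_n_ext with (f := fun y => - - g y).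
- intros y; apply Ropp_involutive.
- now apply ex_derive_n_opp.
Qed.

Lemma alternating_ex_derive_n (Q : R -> Prop) (n : nat) (g : R -> R) (x : R) :
  alternating Q n g -> 0 < x -> ex_derive_n g n x.
Proof.
revert g; induction n as [|n IH]; intros g; [easy|].
intros [_ [g' [Hg' Hn]]] Hx.
apply (ex_derive_n_S_pos g g' n x Hg' Hx), ex_derive_n_oppE.
now apply IH.
Qed.

Lemma alternating_Derive_n (Q : R -> Prop) (n : nat) (g : R -> R) (x : R) :
  alternating Q n g -> 0 < x -> Q ((-1) ^ n * Derive_n g n x).
Proof.
revert g; induction n as [|n IH]; intros g.
- intros [H0 _] Hx; simpl; rewrite Rmult_1_l; now apply H0.
- intros [_ [g' [Hg' Hn]]] Hx.
  rewrite (Derive_n_S_pos g g' n x Hg' Hx).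
  specialize (IH _ Hn Hx); rewrite Derive_n_opp in IH.
  replace ((-1) ^ S n * Derive_n g' n x)
    with ((-1) ^ n * - Derive_n g' n x) by (simpl; ring).
  exact IH.
Qed.

Lemma alternating_of_Derive_n (Q : R -> Prop) (n : nat) (g : R -> R) :
  smooth_on_pos g ->
  (forall k x, 0 < x -> Q ((-1) ^ k * Derive_n g k x)) ->
  alternating Q n g.
Proof.
revert g; induction n as [|n IH]; intros g Hs HQ; simpl;
  (split; [intros x Hx; specialize (HQ O x Hx); simpl in HQ;
           now rewrite Rmult_1_l in HQ |]); [easy|].
assert (Hd : forall y, 0 < y -> is_derive g y (Derive g y))
  by (intros y Hy; apply Derive_correct; exact (Hs 1%nat y Hy)).
exists (Derive g); split; [exact Hd|].
apply IH.
- intros k x Hx; apply ex_derive_n_opp.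
  now apply (ex_derive_n_S_pos g (Derive g) k x Hd Hx), Hs.
- intros k x Hx; rewrite Derive_n_opp.
  specialize (HQ (S k) x Hx).
  rewrite (Derive_n_S_pos g (Derive g) k x Hd Hx) in HQ.
  replace ((-1) ^ k * - Derive_n (Derive g) k x)
    with ((-1) ^ S k * Derive_n (Derive g) k x) by (simpl; ring).
  exact HQ.
Qed.

Lemma smooth_on_pos_alternating (g : R -> R) :
  smooth_on_pos g <-> forall n, alternating (fun _ => True) n g.
Proof.
split.
- intros Hs n; now apply alternating_of_Derive_n.
- intros H n x Hx; exact (alternating_ex_derive_n _ n g x (H n) Hx).
Qed.

Lemma completely_monotonic_alternating (g : R -> R) :
  completely_monotonic g <-> forall n, alternating (fun a => 0 <= a) n g.
Proof.
split.
- intros [Hs Hm] n; now apply alternating_of_Derive_n.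
- intros H; split; intros n x Hx.
  + exact (alternating_ex_derive_n _ n g x (H n) Hx).
  + exact (alternating_Derive_n _ n g x (H n) Hx).
Qed.

(** * Closure properties *)

Lemma alternating_ext (Q : R -> Prop) (n : nat) (g h : R -> R) :
  (forall x, 0 < x -> g x = h x) -> alternating Q n g -> alternating Q n h.
Proof.
intros E; destruct n as [|n]; intros [H0 H1]; simpl;
  (split; [intros x Hx; rewrite <- (E x Hx); now apply H0 |]); [easy|].
destruct H1 as [g' [Hg' Hn]]; exists g'; split; [|exact Hn].
intros x Hx; apply is_derive_ext_loc with (f := g); [|now apply Hg'].
generalize (locally_pos x Hx); apply filter_imp; exact E.
Qed.

Lemma alternating_pred (Q : R -> Prop) (n : nat) (g : R -> R) :
  alternating Q (S n) g -> alternating Q n g.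
Proof.
revert g; induction n as [|n IH]; intros g [H0 [g' [Hg' Hn]]];
  (split; [exact H0|]); [easy|].
exists g'; split; [exact Hg' | now apply IH].
Qed.

Lemma alternating_plus (Q : R -> Prop) (n : nat) (g h : R -> R) :
  add_mul_closed Q -> alternating Q n g -> alternating Q n h ->
  alternating Q n (fun x => g x + h x).
Proof.
intros HQ; revert g h; induction n as [|n IH]; intros g h [G0 G1] [H0 H1];
  (split; [intros x Hx; apply HQ; [now apply G0 | now apply H0] |]); [easy|].
destruct G1 as [g' [Hg' Gn]]; destruct H1 as [h' [Hh' Hn]].
exists (fun x => g' x + h' x); split.
- intros x Hx; apply (is_derive_plus g h); [now apply Hg' | now apply Hh'].
- apply alternating_ext with (g := fun x => - g' x + - h' x).
  + intros x _; ring.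
  + now apply IH.
Qed.

Lemma alternating_mult (Q : R -> Prop) (n : nat) (g h : R -> R) :
  add_mul_closed Q -> alternating Q n g -> alternating Q n h ->
  alternating Q n (fun x => g x * h x).
Proof.
intros HQ; revert g h; induction n as [|n IH]; intros g h Gn Hn;
  pose proof Gn as [G0 G1]; pose proof Hn as [H0 H1];
  (split; [intros x Hx; apply HQ; [now apply G0 | now apply H0] |]); [easy|].
destruct G1 as [g' [Hg' Gn']]; destruct H1 as [h' [Hh' Hn']].
exists (fun x => g' x * h x + g x * h' x); split.
- intros x Hx; apply (is_derive_mult g h); [now apply Hg' | now apply Hh' |].
  exact Rmult_comm.
- apply alternating_ext with (g := fun x => - g' x * h x + g x * - h' x).
  + intros x _; ring.
  + apply alternating_plus; [exact HQ | |]; apply IH; trivial;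
      now apply alternating_pred.
Qed.

Lemma alternating_scal (Q : R -> Prop) (n : nat) (c : R) (g : R -> R) :
  add_mul_closed Q -> Q c -> alternating Q n g ->
  alternating Q n (fun x => c * g x).
Proof.
intros HQ Hc; revert g; induction n as [|n IH]; intros g [G0 G1];
  (split; [intros x Hx; apply HQ; [exact Hc | now apply G0] |]); [easy|].
destruct G1 as [g' [Hg' Gn]].
exists (fun x => c * g' x); split.
- intros x Hx; apply (is_derive_scal g); now apply Hg'.
- apply alternating_ext with (g := fun x => c * - g' x).
  + intros x _; ring.
  + now apply IH.
Qed.

(** * Real powers *)

Lemma is_derive_Rpower (g : R -> R) (c x l : R) :
  0 < g x -> is_derive g x l ->
  is_derive (fun y => Rpower (g y) c) x (c * Rpower (g x) (c - 1) * l).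
Proof.
intros Hx Hg.
replace (c * Rpower (g x) (c - 1) * l)
  with (scal l (c * Rpower (g x) (c - 1)))
  by (unfold scal; simpl; unfold mult; simpl; ring).
apply (is_derive_comp (fun z => Rpower z c) g); [|exact Hg].
apply is_derive_Reals; now apply derivable_pt_lim_power.
Qed.

Lemma Rpower_pred (a c : R) : 0 < a -> Rpower a (c - 1) = Rpower a c / a.
Proof.
intros Ha; unfold Rminus; rewrite Rpower_plus, Rpower_Ropp, Rpower_1; trivial.
Qed.

(** The exponent is kept universally quantified in the induction because
    [(g^c)' = c * g^(c-1) * g'] lowers it by one at each order. *)
Lemma smooth_on_pos_Rpower (g : R -> R) (c : R) :
  smooth_on_pos g -> positive_on_pos g ->
  smooth_on_pos (fun x => Rpower (g x) c).
Proof.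
intros Hs Hp; rewrite smooth_on_pos_alternating in *.
intros n; revert c; induction n as [|n IH]; intros c; (split; [easy|]); [easy|].
destruct (Hs (S n)) as [_ [g' [Hg' Hn]]].
exists (fun x => c * Rpower (g x) (c - 1) * g' x); split.
- intros x Hx; apply is_derive_Rpower; [now apply Hp | now apply Hg'].
- apply alternating_ext with (g := fun x => c * (Rpower (g x) (c - 1) * - g' x)).
  + intros x _; ring.
  + apply alternating_scal; [exact true_add_mul_closed | easy |].
    apply alternating_mult; [exact true_add_mul_closed | apply IH | exact Hn].
Qed.

(** With [phi = - g'/g], the power [h = g^c] satisfies [- h' = c * phi * h], so
    each order of complete monotonicity of [h] produces the next one. *)
Lemma log_completely_monotonic_Rpower (g : R -> R) (c : R) :
  0 <= c -> log_completely_monotonic g ->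
  completely_monotonic (fun x => Rpower (g x) c).
Proof.
intros Hc [Hs [Hp Hm]]; rewrite completely_monotonic_alternating in *.
intros n; induction n as [|n IH];
  (split; [intros x _; apply Rlt_le, exp_pos |]); [easy|].
exists (fun x => c * Rpower (g x) (c - 1) * Derive g x); split.
- intros x Hx; apply is_derive_Rpower; [now apply Hp|].
  apply Derive_correct; exact (Hs 1%nat x Hx).
- apply alternating_ext
    with (g := fun x => c * (- Derive g x / g x * Rpower (g x) c)).
  + intros x Hx; specialize (Hp x Hx); rewrite Rpower_pred by exact Hp.
    field; lra.
  + apply alternating_scal; [exact nonneg_add_mul_closed | exact Hc |].
    apply alternating_mult; [exact nonneg_add_mul_closed | apply Hm | exact IH].
Qed.

(** * Powers of Bernstein functions *)

Theorem proposition5p6 (f : R -> R)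
  (hf : gen_bernstein 1 f)
  (hlog : log_completely_monotonic (fun x : R => f x / x))
  (lambda : R) (hlambda : 1 <= lambda) :
  gen_bernstein lambda (fun x : R => Rpower (f x) lambda).
Proof.
destruct hf as [Hs [Hp Hm]].
split; [now apply smooth_on_pos_Rpower|].
split; [intros x _; apply exp_pos|].
apply (log_completely_monotonic_Rpower _ (lambda - 1)) in hlog; [|lra].
rewrite completely_monotonic_alternating in *; intros n.
apply alternating_ext with
  (g := fun x => lambda * (Rpower x (1 - 1) * Derive f x
                           * Rpower (f x / x) (lambda - 1))).
- intros x Hx; specialize (Hp x Hx).
  pose proof (is_derive_unique _ _ _
                (is_derive_Rpower f lambda x (Derive f x) Hp
                   (Derive_correct _ _ (Hs 1%nat x Hx)))) as E.
  simpl in E |- *; rewrite E.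
  replace (1 - 1) with 0 by ring; rewrite Rpower_O by exact Hx.
  unfold Rdiv; rewrite <- Rpower_mult_distr by (trivial; now apply Rinv_0_lt_compat).
  replace (Rpower (/ x) (lambda - 1)) with (Rpower x (1 - lambda));
    [ring|].
  unfold Rpower; rewrite ln_Rinv by exact Hx; f_equal; ring.
- apply alternating_scal; [exact nonneg_add_mul_closed | lra |].
  apply alternating_mult; [exact nonneg_add_mul_closed | apply Hm | apply hlog].
Qed.
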